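(* Let $k\ge1$ and let $\{S_{\mathbf n},\mathbf n\in\mathbb N^k\}$ be a multiindexed demisubmartingale with $S_{\boldsymbol\ell}=0$ when $\prod_{i=1}^k\ell_i=0$. Then for all $\mathbf n\in\mathbb N^k$, all real $a<b$ and all $1\le s\le k$, the number $U_{n_s}(a,b)$ of complete upcrossings of $[a,b]$ in the $s$-th direction until time $n_s$ satisfies $$E\big(U_{n_s}(a,b)\big)\le\frac{E\big((S_{\mathbf n}-a)^+\big)-E\big((S_{\mathbf n;s;1}-a)^+\big)}{b-a}.$$
   Context: All random variables are real-valued and defined on one probability space. $\mathbb N^k$ is the $k$-dimensional lattice of positive integers; $\mathbf i\le\mathbf j$ means $i_m\le j_m$ for all $m$; $x^+=\max\{x,0\}$. For $\mathbf n=(n_1,\dots,n_k)$, $\mathbf n;s;j=(n_1,\dots,n_{s-1},j,n_{s+1},\dots,n_k)$. The array is extended to indices $\boldsymbol\ell$ with nonnegative integer coordinates by $S_{\boldsymbol\ell}=0$ when some coordinate is $0$. A collection $\{S_{\mathbf n},\mathbf n\in\mathbb N^k\}$ is a multiindexed demisubmartingale if $E[(S_{\mathbf j}-S_{\mathbf i})f(S_{\mathbf k},\mathbf k\le\mathbf i)]\ge0$ for all $\mathbf i,\mathbf j\in\mathbb N^k$ with $\mathbf i\le\mathbf j$ and all nonnegative componentwise nondecreasing functions $f$, provided the expectation is defined. Upcrossings in direction $s$ (for fixed $\mathbf n$ and $a<b$): put $J^{(s)}_0=0$ and, for $m=1,2,\dots$, let $J^{(s)}_{2m-1}=\min\{j:J^{(s)}_{2m-2}<j\le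 n_s,\ S_{\mathbf n;s;j}\le a\}$, or $n_s+1$ if this set is empty; $J^{(s)}_{2m}=\min\{j:J^{(s)}_{2m-1}<j\le n_s,\ S_{\mathbf n;s;j}\ge b\}$, or $n_s+1$ if this set is empty. Then $U_{n_s}(a,b)=\max\{m\ge0:J^{(s)}_{2m}<n_s+1\}$. *)

(* Defs.v *)
From HB Require Import structures.
From mathcomp Require Import all_boot all_order all_algebra.
From mathcomp Require Import all_classical all_reals all_analysis.

Set Implicit Arguments.
Unset Strict Implicit.
Unset Printing Implicit Defensive.

Import Order.TTheory GRing.Theory Num.Theory.

Local Open Scope ring_scope.

(* Indices have nonnegative coordinates; the lattice N^k of positive integers
   is the subset [positive_index]. *)
Definition multiindex (k : nat) := {ffun 'I_k -> nat}.

Definition positive_index k (i : multiindex k) : bool :=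
  [forall m, 0 < i m]%N.

Definition index_le k (i j : multiindex k) : bool := [forall m, i m <= j m]%N.

(* n;s;j *)
Definition subst_index k (n : multiindex k) (s : 'I_k) (j : nat) : multiindex k :=
  [ffun m => if m == s then j else n m].

(* The indices of the family (S_l, l <= i) with l in N^k. *)
Definition index_below k (i : multiindex k) :=
  {l : multiindex k | positive_index l && index_le l i}.

Definition componentwise_nondecreasing (I : Type) (R : realType)
    (f : (I -> R) -> R) : Prop :=
  forall x y : I -> R, (forall l, x l <= y l) -> f x <= f y.

(* The expectation exists in [-oo, +oo]: X is measurable and E(X^+), E(X^-) are
   not both infinite. *)
Definition expectation_defined d (T : measurableType d) (R : realType)
    (P : probability T R) (X : T -> R) : Prop :=
  measurable_fun [set: T] X /\ ('E_P[X^\+%R] +? - 'E_P[X^\-%R])%E.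

Definition multiindexed_demisubmartingale d (T : measurableType d)
    (R : realType) (P : probability T R) (k : nat)
    (S : multiindex k -> {RV P >-> R}) : Prop :=
  forall i j : multiindex k,
    positive_index i -> positive_index j -> index_le i j ->
  forall f : (index_below i -> R) -> R,
    (forall x, 0 <= f x) -> componentwise_nondecreasing f ->
    let X := fun w : T => (S j w - S i w) * f (fun l => S (val l) w) in
    expectation_defined P X -> (0 <= 'E_P[X])%E.

(* min {j : t < j <= N, p j}, or N.+1 if this set is empty *)
Definition first_after (N : nat) (p : pred nat) (t : nat) : nat :=
  \big[minn/N.+1]_(t.+1 <= j < N.+1 | p j) j.

(* The times J_m of the path x up to the horizon N: J_m searches for a value
   <= a when m is odd and for a value >= b when m is even and positive. *)
Fixpoint crossing_time (R : realType) (x : nat -> R) (a b : R) (N m : nat)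
    : nat :=
  if m is m'.+1 then
    first_after N (fun j => if odd m then x j <= a else b <= x j)
      (crossing_time x a b N m')
  else 0%N.

(* max {m >= 0 : J_{2m} < N + 1}; the bound m <= N loses nothing, see
   [upcrossings_max]. *)
Definition upcrossings (R : realType) (x : nat -> R) (a b : R) (N : nat)
    : nat :=
  (\max_(m < N.+1 | crossing_time x a b N m.*2 < N.+1) m)%N.

Lemma first_after_gt N p t : (t <= N)%N -> (t < first_after N p t)%N.
Proof.
move=> tN; rewrite /first_after big_nat_cond.
by elim/big_ind: _ => // [u v *|u /andP[/andP[//]]]; rewrite leq_min; apply/andP.
Qed.

Lemma first_after_out N p t : (N < t)%N -> first_after N p t = N.+1.
Proof. by move=> tN; rewrite /first_after big_geq // ltnW. Qed.

Lemma upcrossings_max (R : realType) (x : nat -> R) (a b : R) (N : nat) :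
  (crossing_time x a b N (upcrossings x a b N).*2 < N.+1)%N /\
  forall m, (crossing_time x a b N m.*2 < N.+1)%N ->
    (m <= upcrossings x a b N)%N.
Proof.
have Jge m : (crossing_time x a b N m < N.+1)%N ->
    (m <= crossing_time x a b N m)%N.
  elim: m => // m IH /=.
  have [Jm|Jm] := leqP (crossing_time x a b N m) N; last first.
    by rewrite first_after_out // ltnn.
  by move=> _; apply: leq_ltn_trans (IH Jm) _; exact: first_after_gt.
split.
  have h0 : (crossing_time x a b N (@ord0 N).*2 < N.+1)%N by [].
  by rewrite /upcrossings (bigop.bigmax_eq_arg ord0) //; case: arg_maxnP.
move=> m Jm.
have mN : (m < N.+1)%N.
  apply: leq_ltn_trans (Jm); apply: leq_trans (Jge _ Jm).
  by rewrite -addnn leq_addr.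
exact: (@bigop.leq_bigmax_cond _ _ _ (Ordinal mN)).
Qed.

(* Main.v *)
Require Import Defs.
From mathcomp Require Import all_boot all_order all_algebra.
From mathcomp Require Import all_classical all_reals all_analysis.
From mathcomp Require Import measurable_realfun zify lra.

Set Implicit Arguments.
Unset Strict Implicit.
Unset Printing Implicit Defensive.

Import Order.TTheory GRing.Theory Num.Theory.

Local Open Scope ring_scope.

(* Put X_j = S_{n;s;j} and let e_j indicate that at time j the path is outside
   an upcrossing period.  Then e_j is a nondecreasing function of X_1, ..., X_j,
   and e_j = 1 forces X_j > a.  Pathwise, with N = n_s,
     (b - a) U_N + (X_1 - a)^+ + sum_{1 <= j < N} e_j (X_{j+1} - X_j) <= (X_N - a)^+,
   and the demisubmartingale property makes each term of the sum nonnegative in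
   expectation.  No integrability of X_j is needed: if E (X_N - a)^+ is finite,
   testing the increment X_N - X_j against 1{X_j > a} gives E (X_j - a)^+ finite,
   which bounds the positive parts of the e_j (X_{j+1} - X_j); if it is infinite,
   so is the right-hand side. *)

(** * First hitting times after a given time *)

Lemma first_after_le N p t : (first_after N p t <= N.+1)%N.
Proof.
rewrite /first_after big_nat_cond.
elim/big_ind: _ => // [u v uN vN|u /andP[/andP[_ /ltnW //]]].
by rewrite geq_min uN.
Qed.

Lemma first_after_ge N p t : (t <= N.+1)%N -> (t <= first_after N p t)%N.
Proof.
rewrite leq_eqVlt => /predU1P[->|tN]; first by rewrite first_after_out.
exact/ltnW/first_after_gt.
Qed.

Lemma first_after_min N (p : pred nat) t j : (t < j <= N)%N -> p j ->
  (first_after N p t <= j)%N.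
Proof.
move=> tjN pj; rewrite /first_after.
have: j \in index_iota t.+1 N.+1 by rewrite mem_index_iota ltnS.
elim: (index_iota _ _) => //= i r IH; rewrite inE big_cons.
case/predU1P => [<-|/IH jr]; first by rewrite pj geq_min leqnn.
by case: ifP => // _; rewrite geq_min jr orbT.
Qed.

Lemma first_after_sat N (p : pred nat) t : (first_after N p t <= N)%N ->
  p (first_after N p t).
Proof.
rewrite /first_after; elim/big_ind: _ => [|u v pu pv|//]; first by rewrite ltnn.
by rewrite /minn; case: ifP.
Qed.

(** * Pathwise upcrossing inequality *)

Section Path.
Variables (R : realType) (x : nat -> R) (a b : R).

(* Whether, after time [i], the path is outside an upcrossing period, i.e.
   J_{2m} <= i < J_{2m+1} for some m. *)
Fixpoint waiting_low (i : nat) : bool :=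
  if i is i'.+1 then (waiting_low i' && (a < x i)) || (b <= x i) else true.

(** Indexed by the time before completion: the upcrossing ends at [i.+1]. *)
Definition completes (i : nat) : bool := ~~ waiting_low i && (b <= x i.+1).

Lemma crossing_time_le N m : (crossing_time x a b N m <= N.+1)%N.
Proof. by case: m => //= m; exact: first_after_le. Qed.

Lemma crossing_time_homo N :
  {homo crossing_time x a b N : m m' / (m <= m')%N}.
Proof.
apply: homo_leq => //[? ? ? |m]; first exact: leq_trans.
exact/first_after_ge/crossing_time_le.
Qed.

(** Here [m] counts the crossing times up to [j]: two for each completed upcrossing, one more for an
    upcrossing in progress. Its parity tells which level is sought next, and each time step raises
    it by at most one. *)
Lemma crossing_time_state N j : a < b -> (j <= N)%N ->
  let m := ((\sum_(i < j) completes i).*2 + ~~ waiting_low j)%N in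
  (crossing_time x a b N m <= j < crossing_time x a b N m.+1)%N.
Proof.
move=> ab; elim: j => [|j IH] jN; first by rewrite big_ord0 /=; exact: first_after_gt.
have := IH (ltnW jN).
set m := (_ + _)%N => /= /andP[Jm Jm1].
set p := (fun i => _) in Jm1.
have oddm : odd m = ~~ waiting_low j by rewrite oddD odd_double; case: waiting_low.
have pE i : p i = if waiting_low j then x i <= a else b <= x i.
  by rewrite /p oddm; case: waiting_low.
have step : (p j.+1 -> let m' := m.+1 in
      (crossing_time x a b N m' <= j.+1 < crossing_time x a b N m'.+1)%N)
   /\ (~~ p j.+1 -> (crossing_time x a b N m <= j.+1 < crossing_time x a b N m.+1)%N).
  split=> pj.
    have Jle : (crossing_time x a b N m.+1 <= j.+1)%N.
      by apply: first_after_min => //; rewrite ltnS Jm.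
    have JE : crossing_time x a b N m.+1 = j.+1 by apply/eqP; rewrite eqn_leq Jle.
    by rewrite /= -/p -/(crossing_time x a b N m.+1) JE leqnn first_after_gt.
  rewrite (leq_trans Jm) // ltn_neqAle Jm1 andbT.
  apply: contra pj => /eqP E; rewrite E; apply: first_after_sat; rewrite -/p.
  by rewrite -[X in (X <= _)%N]E.
rewrite big_ord_recr /= /completes.
move: step; rewrite pE /m.
case: (waiting_low j) => /=; rewrite ?addn0 ?addn1.
  rewrite leNgt => -[h1 h2]; case: (ltP a (x j.+1)) => [ax|xa] /=.
    by rewrite addn0 h2 ?ax.
  (* Since [a < b], an upcrossing cannot end at the time at which it starts. *)
  have -> /= : (b <= x j.+1) = false by apply/negbTE; rewrite -ltNge (le_lt_trans xa).
  by rewrite addn1; apply: h1; rewrite -leNgt.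
move=> -[h1 h2]; case: (b <= x j.+1) in h1 h2 *; rewrite /= ?addn1 ?addn0.
  by rewrite doubleS; exact: h1.
exact: h2.
Qed.

(** The last crossing time not exceeding [N] has index 2c or 2c+1, where c is the number of
    completions; hence c is the largest m with J_{2m} at most [N]. *)
Lemma upcrossingsE N : a < b ->
  upcrossings x a b N = (\sum_(i < N) completes i)%N.
Proof.
move=> ab; have [Ju uM] := upcrossings_max x a b N.
have /andP[Jm Jm1] := crossing_time_state ab (leqnn N).
apply/eqP; rewrite eqn_leq; apply/andP; split.
  have : ((upcrossings x a b N).*2 <
          ((\sum_(i < N) completes i).*2 + ~~ waiting_low N).+1)%N.
    rewrite ltnNge; apply/negP => /(crossing_time_homo N).
    by rewrite leqNgt (leq_trans _ Jm1).
  by case: waiting_low => /=; lia.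
apply: uM; rewrite ltnS; apply: leq_trans Jm.
exact/crossing_time_homo/leq_addr.
Qed.

Lemma waiting_low_gt i : a < b -> waiting_low i.+1 -> a < x i.+1.
Proof. by move=> ab /orP[/andP[]//|]; exact: lt_le_trans. Qed.

(* [waiting_low j * (x j - a)] is the potential that telescopes. *)
Lemma upcrossings_path N : a < b -> (0 < N)%N ->
  (b - a) * (upcrossings x a b N)%:R + Num.max (x 1%N - a) 0
    + \sum_(1 <= i < N) (x i.+1 - x i) * (waiting_low i)%:R
  <= Num.max (x N - a) 0.
Proof.
case: N => // N ab _; rewrite upcrossingsE //.
(* The induction runs on the sharper bound by the potential, which is at most the positive part. *)
apply: (@le_trans _ _ ((waiting_low N.+1)%:R * (x N.+1 - a))); last first.
  case: (boolP (waiting_low N.+1)) => _; rewrite ?mul1r ?mul0r le_max lexx//.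
  by rewrite orbT.
elim: N => [|N IH].
  rewrite big_geq // big_ord_recl big_ord0 /completes [waiting_low 0]/=.
  rewrite add0n mulr0 add0r addr0 [waiting_low 1]/=.
  by case: (ltP a (x 1%N)) => ? /=; case: (leP b (x 1%N)) => /= ?;
     rewrite ge_max ?mul1r ?mul0r; apply/andP; split; lra.
rewrite big_ord_recr [in leLHS]big_nat_recr //= natrD.
have := IH; rewrite /completes.
have := @waiting_low_gt N ab.
rewrite -/(waiting_low N.+1).
set M := Num.max _ _.
(* While waiting, the new increment turns the potential into [x N.+2 - a], and resetting it to 0
   when [x N.+2 <= a] only raises it. Otherwise the increment has weight 0, and a completion pays
   [b - a] out of the new potential [x N.+2 - a]. *)
case: (waiting_low N.+1) => h; rewrite /= ?mulr1 ?mulr0 ?mul1r ?mul0r.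
  have {}h := h isT.
  case: (ltP a (x N.+2)) => ?; case: (leP b (x N.+2)) => ?;
    rewrite /= ?mulr1 ?mulr0 ?mul1r ?mul0r; lra.
case: (leP b (x N.+2)) => ?; rewrite /= ?mulr1 ?mulr0 ?mul1r ?mul0r; lra.
Qed.

End Path.

(** This makes the waiting indicator an admissible test function: it is built from lower bounds on
    the path by conjunction and disjunction only. *)
Lemma waiting_low_homo (R : realType) (x y : nat -> R) a b i :
  (forall j, (0 < j <= i)%N -> x j <= y j) ->
  waiting_low x a b i -> waiting_low y a b i.
Proof.
elim: i => //= i IH xy.
have xyi := xy i.+1 (leqnn _).
case/orP => [/andP[w ax]|bx]; last by rewrite (le_trans bx) ?orbT.
rewrite IH ?(lt_le_trans ax) // => j /andP[j0 ji]; apply: xy.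
by rewrite j0 ltnW.
Qed.

(** * Integrability criteria *)

Lemma measurable_natr_bool d (T : measurableType d) (R : realType)
    (f : T -> bool) :
  measurable_fun setT f -> measurable_fun setT (fun w => (f w)%:R : R).
Proof.
move=> mf; rewrite [X in measurable_fun _ X](_ : _ = fun w => if f w then 1 else 0).
  exact: measurable_fun_ifT.
by apply/funext => w; case: (f w).
Qed.

Section Lfun1.
Context d (T : measurableType d) (R : realType) (P : probability T R).

Lemma Lfun1_le (f g : T -> R) : measurable_fun setT f ->
  (forall w, `|f w| <= `|g w|) -> g \in Lfun P 1 -> f \in Lfun P 1.
Proof.
move=> mf fg /Lfun1_integrable gi; apply/Lfun1_integrable.
apply: le_integrable gi => //; first exact/measurable_EFinP.
by move=> w _ /=; rewrite lee_fin.
Qed.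

Lemma ge0_Lfun1 (f : T -> R) : measurable_fun setT f ->
  (forall w, 0 <= f w) -> ('E_P[f] < +oo)%E -> f \in Lfun P 1.
Proof.
move=> mf f0; rewrite unlock => fi.
apply/Lfun1_integrable/integrableP; split; first exact/measurable_EFinP.
apply: le_lt_trans fi; apply: ge0_le_integral => //=.
- by apply/measurable_EFinP; exact: measurableT_comp.
- exact/measurable_EFinP.
- by move=> w _; rewrite ger0_norm.
Qed.

Lemma Lfun1_lt_pinfty (f : T -> R) : f \in Lfun P 1 -> ('E_P[f] < +oo)%E.
Proof. by move=> /expectation_fin_num; rewrite fin_numElt => /andP[]. Qed.

Lemma Lfun1_expectation_le (f g : T -> R) : f \in Lfun P 1 -> g \in Lfun P 1 ->
  (forall w, f w <= g w) -> ('E_P[f] <= 'E_P[g])%E.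
Proof.
move=> /Lfun1_integrable fi /Lfun1_integrable gi fg; rewrite unlock.
by apply: le_integral => // w _; rewrite lee_fin.
Qed.

Lemma expectationE (f : T -> R) :
  ('E_P[f] = 'E_P[f^\+%R] - 'E_P[f^\-%R])%E.
Proof. by rewrite unlock integralE funerpos funerneg. Qed.

(** From E Z = E Z^+ - E Z^- >= 0 one gets E Z^- <= E Z^+, which is finite. *)
Lemma Lfun1_of_funrpos (Z : T -> R) : measurable_fun setT Z ->
  Z^\+%R \in Lfun P 1 -> (0 <= 'E_P[Z])%E -> Z \in Lfun P 1.
Proof.
move=> mZ Zp; have Zpf := expectation_fin_num Zp.
rewrite expectationE subre_ge0 // => Znp.
rewrite -(funrposBneg Z) rpredB //.
apply: ge0_Lfun1; first exact: measurable_funrneg.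
  by move=> w; exact: funrneg_ge0.
exact: le_lt_trans Znp (Lfun1_lt_pinfty Zp).
Qed.

End Lfun1.

(** * Weighted increments of a demisubmartingale *)

Section Demisubmartingale.
Context d (T : measurableType d) (R : realType) (P : probability T R).
Context k (S : multiindex k -> {RV P >-> R}).
Hypothesis hS : multiindexed_demisubmartingale S.

(* The positive part of the weighted increment is at most [(S j - a)^+], so its
   expectation is defined although [S i] and [S j] need not be integrable. *)
Lemma demisubmartingale_increment (i j : multiindex k) (a : R)
    (h : (index_below i -> R) -> bool) :
  positive_index i -> positive_index j -> index_le i j ->
  (forall x y, (forall l, x l <= y l) -> h x -> h y) ->
  measurable_fun setT (fun w => h (fun l => S (val l) w)) ->
  (forall w, h (fun l => S (val l) w) -> a < S i w) ->
  (fun w => Num.max (S j w - a) 0) \in Lfun P 1 ->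
  let Z w := (S j w - S i w) * (h (fun l => S (val l) w))%:R in
  Z \in Lfun P 1 /\ (0 <= 'E_P[Z])%E.
Proof.
set hw := fun w => h (fun l => S (val l) w).
move=> pi pj ij h_mono mh ha Yj Z.
have mZ : measurable_fun setT Z.
  rewrite /Z; apply: measurable_funM; first exact: measurable_funB.
  exact: measurable_natr_bool.
have Zp : Z^\+%R \in Lfun P 1.
  apply: Lfun1_le Yj; first exact: measurable_funrpos.
  move=> w; rewrite ger0_norm ?funrpos_ge0// ger0_norm; last by rewrite le_max lexx orbT.
  rewrite /funrpos /Z; have := ha w; rewrite -/(hw w); case: (hw w) => h1; last first.
    by rewrite mulr0 maxxx le_max lexx orbT.
  by rewrite mulr1 ge_max !le_max lexx !orbT lerB // ltW ?h1.
have EZ : (0 <= 'E_P[Z])%E.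
  apply: (hS pi pj ij (f := fun x => (h x)%:R)) => //.
    move=> x y xy; rewrite ler_nat; case: (h x) (h_mono x y xy) => // ->//.
  split; first exact: mZ.
  exact/fin_num_adde_defr/expectation_fin_num.
by split=> //; exact: Lfun1_of_funrpos.
Qed.

End Demisubmartingale.

(** * Measurability of upcrossing counts, and sums of increments *)

Lemma measurable_waiting_low d (T : measurableType d) (R : realType)
    (x : nat -> T -> R) a b i :
  (forall j, measurable_fun setT (x j)) ->
  measurable_fun setT (fun w => waiting_low (x^~ w) a b i).
Proof.
move=> mx; elim: i => [|i IH] /=; first exact: measurable_cst.
apply: measurable_or; last exact: measurable_fun_ler.
by apply: measurable_and => //; exact: measurable_fun_ltr.
Qed.

Lemma measurable_upcrossings d (T : measurableType d) (R : realType)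
    (x : nat -> T -> R) a b N : a < b ->
  (forall j, measurable_fun setT (x j)) ->
  measurable_fun setT (fun w => (upcrossings (x^~ w) a b N)%:R : R).
Proof.
move=> ab mx; under eq_fun do rewrite upcrossingsE // natr_sum.
apply: measurable_sum => i; apply: measurable_natr_bool.
apply: measurable_and; last exact: measurable_fun_ler.
exact/measurable_neg/measurable_waiting_low.
Qed.

Lemma expectation_sum_ge0 d (T : measurableType d) (R : realType)
    (P : probability T R) (I : eqType) (r : seq I) (Z : I -> T -> R) :
  {in r, forall i, Z i \in Lfun P 1 /\ (0 <= 'E_P[Z i])%E} ->
  (fun w => \sum_(i <- r) Z i w) \in Lfun P 1 /\
  (0 <= 'E_P[fun w => (\sum_(i <- r) Z i w)%R])%E.
Proof.
elim: r => [_|i r IH hZ].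
  under eq_fun do rewrite big_nil.
  by split; [exact: Lfun_cst|rewrite expectation_cst].
have [Zi Zi0] := hZ i (mem_head _ _).
have [|s1 s0] := IH; first by move=> j jr; apply: hZ; rewrite inE jr orbT.
rewrite (_ : (fun w => _) = (Z i \+ fun w => \sum_(i <- r) Z i w)); last first.
  by apply/funext => w; rewrite big_cons.
by rewrite rpredD // expectationD // adde_ge0.
Qed.

(** * The inequality along a line in direction [s] *)

Section Direction.
Variables (k : nat) (n : multiindex k) (s : 'I_k).
Hypothesis hn : positive_index n.

Lemma positive_subst j : (0 < j)%N -> positive_index (subst_index n s j).
Proof.
move=> j0; apply/forallP => m; rewrite ffunE; case: ifP => // _.
exact: (forallP hn).
Qed.

Lemma subst_index_le i j : (i <= j)%N ->
  index_le (subst_index n s i) (subst_index n s j).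
Proof. by move=> ij; apply/forallP => m; rewrite !ffunE; case: ifP. Qed.

Lemma subst_index_id : subst_index n s (n s) = n.
Proof. by apply/ffunP => m; rewrite ffunE; case: eqP => [->|]. Qed.

(** Rebuilds a path from the family below its index at time [i]. The default 0 is taken at time 0
    and after [i], where the test functions do not look. *)
Definition line_path (V : nmodType) i
    (x : index_below (subst_index n s i) -> V) (j : nat) : V :=
  oapp x 0 (insub (subst_index n s j)).

Lemma line_pathE (V : nmodType) i (z : multiindex k -> V) j :
  (0 < j <= i)%N ->
  line_path (fun l : index_below (subst_index n s i) => z (val l)) j =
  z (subst_index n s j).
Proof.
move=> /andP[j0 ji]; rewrite /line_path insubT //.
by rewrite positive_subst // subst_index_le.
Qed.

Context d (T : measurableType d) (R : realType) (P : probability T R).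
Context (S : multiindex k -> {RV P >-> R}).
Hypothesis hS : multiindexed_demisubmartingale S.
Let X j w := S (subst_index n s j) w.

Lemma line_increment a i j (g : (nat -> R) -> bool) :
  (0 < i <= j)%N ->
  (forall x y, (forall l, (0 < l <= i)%N -> x l <= y l) -> g x -> g y) ->
  measurable_fun setT (fun w => g (X^~ w)) ->
  (forall w, g (X^~ w) -> a < X i w) ->
  (fun w => Num.max (X j w - a) 0) \in Lfun P 1 ->
  let Z w := (X j w - X i w) * (g (X^~ w))%:R in
  Z \in Lfun P 1 /\ (0 <= 'E_P[Z])%E.
Proof.
move=> /andP[i0 ij] g_mono mg ga Yj Z.
pose h (x : index_below (subst_index n s i) -> R) := g (line_path x).
(* Monotonicity of [g], used both ways, makes it depend only on times 1 to [i], where the two paths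
   agree. *)
have hE w : h (fun l => S (val l) w) = g (X^~ w).
  rewrite /h; apply/idP/idP; apply: g_mono => l li;
    by rewrite (line_pathE (fun l => S l w)).
have -> : Z = fun w => (X j w - X i w) * (h (fun l => S (val l) w))%:R.
  by apply/funext => w; rewrite hE.
apply: (demisubmartingale_increment hS _ _ _ (a := a) (h := h)) => //.
- exact: positive_subst.
- exact/positive_subst/(leq_trans i0).
- exact: subst_index_le.
- move=> x y xy; apply: g_mono => l _; rewrite /line_path.
  by case: insub => //=.
- by under eq_fun do rewrite hE.
- by move=> w; rewrite hE; exact: ga.
Qed.

Lemma line_excess_Lfun1 a i j : (0 < i <= j)%N ->
  (fun w => Num.max (X j w - a) 0) \in Lfun P 1 ->
  (fun w => Num.max (X i w - a) 0) \in Lfun P 1.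
Proof.
move=> ij Yj.
have mX l : measurable_fun setT (X l) by exact: measurable_funPT.
have [|||Zi _] := line_increment (g := fun x => a < x i) ij _ _ _ Yj.
- move=> x y xy ax; apply: lt_le_trans ax (xy _ _).
  by case/andP: ij => ->/=.
- exact: measurable_fun_ltr.
- by [].
(* Domination: (X_i - a)^+ <= (X_j - a)^+ - (X_j - X_i) 1{X_i > a}. *)
apply: Lfun1_le (rpredB Yj Zi) => //.
  by apply: measurable_maxr => //; exact: measurable_funB.
move=> w; rewrite ger0_norm ?le_max ?lexx ?orbT //.
apply: le_trans (ler_norm _); rewrite !fctE.
have Xj : X j w - a <= Num.max (X j w - a) 0 by rewrite le_max lexx.
case: (ltP a (X i w)) => ax; rewrite ?mulr1 ?mulr0.
  by rewrite max_l; lra.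
by rewrite max_r; [rewrite subr0 le_max lexx orbT|lra].
Qed.

Lemma expectation_upcrossings a b (N : nat) : a < b -> (0 < N)%N ->
  (fun w => Num.max (X N w - a) 0) \in Lfun P 1 ->
  ('E_P[fun w => (upcrossings (X^~ w) a b N)%:R : R] * (b - a)%:E
   <= 'E_P[fun w => Num.max (X N w - a)%R 0%R]
      - 'E_P[fun w => Num.max (X 1%N w - a)%R 0%R])%E.
Proof.
move=> ab N0 YN.
have mX l : measurable_fun setT (X l) by exact: measurable_funPT.
have Y i : (0 < i <= N)%N -> (fun w => Num.max (X i w - a) 0) \in Lfun P 1.
  by move=> iN; exact: line_excess_Lfun1 YN.
pose Z i w := (X i.+1 w - X i w) * (waiting_low (X^~ w) a b i)%:R.
have [|ZL Z0] := @expectation_sum_ge0 _ T R P _ (index_iota 1 N) Z.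
  move=> i; rewrite mem_index_iota => /andP[i0 iN].
  apply: (line_increment (a := a) (g := fun x => waiting_low x a b i)).
  - by rewrite i0 leqW.
  - by move=> x y; exact: waiting_low_homo.
  - exact: measurable_waiting_low.
  (* At time 0 waiting gives no lower bound on the path, so the sum starts at 1. *)
  - by case: i i0 {iN} => // i _ w; exact: waiting_low_gt.
  - exact: Y.
pose U w : R := (upcrossings (X^~ w) a b N)%:R.
have UL : U \in Lfun P 1.
  apply: (@Lfun1_le _ _ _ _ _ (cst N%:R)); last exact: Lfun_cst.
    exact: measurable_upcrossings.
  move=> w; rewrite !ger0_norm ?ler0n // ler_nat.
  by apply/bigmax_leqP => m _; rewrite -ltnS.
have bUL : (b - a) \o* U \in Lfun P 1 by exact: Lfun_scale.
rewrite -expectationB ?Y // ?leqnn ?N0 // muleC -expectationZl //.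
(* Adding the sum of increments can only raise the expectation, and then the pathwise inequality
   applies. *)
apply: le_trans (_ : 'E_P[((b - a) \o* U) \+
   (fun w => \sum_(1 <= i < N) Z i w)%R] <= _)%E.
  by rewrite expectationD // leeDl.
apply: Lfun1_expectation_le; [exact: rpredD | by rewrite rpredB ?Y ?leqnn ?N0 |].
move=> w /=; have := upcrossings_path (X^~ w) ab N0.
rewrite /U /Z mulrC; lra.
Qed.

End Direction.

Theorem theorem6p2 (d : measure_display) (T : measurableType d) (R : realType)
    (P : probability T R) (k : nat) (hk : (1 <= k)%N)
    (S : multiindex k -> {RV P >-> R})
    (hS : multiindexed_demisubmartingale S)
    (hS0 : forall l : multiindex k,
       (\prod_(i < k) l i)%N = 0%N -> forall w : T, S l w = 0)
    (n : multiindex k) (hn : positive_index n) (a b : R) (hab : a < b) (s : 'I_k)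
    (* the difference on the right-hand side is not +oo - +oo *)
    (hdef : ('E_P[fun w => Num.max (S n w - a)%R 0%R]
             +? - 'E_P[fun w => Num.max (S (subst_index n s 1) w - a)%R 0%R])%E) :
  ('E_P[fun w : T =>
          ((upcrossings (fun j => S (subst_index n s j) w) a b (n s))%:R : R)%R]
   <= ('E_P[fun w => Num.max (S n w - a)%R 0%R]
       - 'E_P[fun w => Num.max (S (subst_index n s 1) w - a)%R 0%R])
      / (b - a)%:E)%E.
Proof.
have ba : 0 < b - a by rewrite subr_gt0.
rewrite inver gt_eqF //.
have Y0 l w : 0 <= Num.max (S l w - a) 0 by rewrite le_max lexx orbT.
have mY l : measurable_fun setT (fun w => Num.max (S l w - a) 0).
  by apply: measurable_maxr => //; exact: measurable_funB.
case: (ltP 'E_P[fun w => Num.max (S n w - a)%R 0%R]%E +oo%E) => [Yfin|].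
  rewrite lee_pdivlMr //.
  have := expectation_upcrossings (s := s) hn hS hab (forallP hn s).
  rewrite /= subst_index_id; apply; exact: ge0_Lfun1.
(* By [hdef] the subtracted expectation is not [+oo], so the right-hand side is [+oo]. *)
rewrite leye_eq => /eqP En; move: hdef; rewrite En.
case: ('E_P[fun w => Num.max (S (subst_index n s 1) w - a)%R 0%R])%E => //= [r|] _.
  by rewrite gt0_mulye ?lte_fin ?invr_gt0 // leey.
by rewrite gt0_mulye ?lte_fin ?invr_gt0 // leey.
Qed.
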